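(* There is a single interpretation of arithmetic $(\mathbb{Z},+,\times)$ which is uniform in the class of polynomial rings $S$ satisfying one of the following: (1) $S=B[\mathcal{X}]$ where $\mathcal{X}$ is a nonempty set of indeterminates and $B$ is a reduced indecomposable commutative unital ring that is not a field; or (2) $S=R[x]$ is a polynomial ring in one indeterminate over a field $R$ having an element of infinite multiplicative order.
   Context: A commutative unital ring is reduced if its only nilpotent element is $0$, and indecomposable if its only idempotents are $0$ and $1$. An interpretation $\Gamma$ of a structure $\mathfrak{M}'$ in a structure $\mathfrak{M}$ consists of a domain formula $\partial_\Gamma$ in $n$ variables defining $\Delta_\Gamma\subseteq M^n$, a surjective coordinate map $F_\Gamma:\Delta_\Gamma\to M'$, and formulas $=_\Gamma$, and $G_\Gamma$ for each function/relation symbol of $\mathfrak{M}'$, defining in $\mathfrak{M}$ the pullbacks under $F_\Gamma$ of equality and of the graphs of the functions/relations of $\mathfrak{M}'$. It is uniform in a class of structures if all these formulas are the same for every structure in the class (only the coordinate map may vary). *)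

(* Defs.v *)
From HB Require Import structures.
From mathcomp Require Import all_boot all_order all_algebra.
Set Implicit Arguments. Unset Strict Implicit. Unset Printing Implicit Defensive.
Import Order.TTheory GRing.Theory Num.Theory.
Local Open Scope ring_scope.

Inductive term : Type :=
  | TVar of nat
  | TZero
  | TOne
  | TAdd of term & term
  | TNeg of term
  | TMul of term & term.

Inductive formula : Type :=
  | FEq of term & term
  | FNot of formula
  | FAnd of formula & formula
  | FOr of formula & formula
  | FEx of nat & formula
  | FAll of nat & formula.

Fixpoint teval (S : comNzRingType) (v : nat -> S) (t : term) : S :=
  match t with
  | TVar i => v i
  | TZero => 0
  | TOne => 1
  | TAdd t1 t2 => teval v t1 + teval v t2
  | TNeg t1 => - teval v t1
  | TMul t1 t2 => teval v t1 * teval v t2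
  end.

Definition upd (S : Type) (v : nat -> S) (i : nat) (a : S) : nat -> S :=
  fun j => if j == i then a else v j.

Fixpoint sat (S : comNzRingType) (v : nat -> S) (phi : formula) : Prop :=
  match phi with
  | FEq t1 t2 => teval v t1 = teval v t2
  | FNot p => ~ sat v p
  | FAnd p q => sat v p /\ sat v q
  | FOr p q => sat v p \/ sat v q
  | FEx i p => exists a : S, sat (upd v i a) p
  | FAll i p => forall a : S, sat (upd v i a) p
  end.

Definition env (S : comNzRingType) (s : seq S) : nat -> S := fun i => nth 0 s i.

(* The formulas of an n-dimensional interpretation of (Z,+,x):
   a domain formula in n variables, a formula for the pullback of equality
   in 2n variables, and formulas for the pullbacks of the graphs of + and x
   in 3n variables (the i-th block of n variables is the i-th tuple). *)
Record interp_formulas := InterpFormulas {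
  idim : nat;
  idom : formula;
  ieq  : formula;
  iadd : formula;
  imul : formula }.

Definition is_interpretation (Gam : interp_formulas) (S : comNzRingType)
    (F : (idim Gam).-tuple S -> int) : Prop :=
  let Delta := fun a : (idim Gam).-tuple S => sat (env a) (idom Gam) in
  [/\ (forall z : int, exists2 a, Delta a & F a = z),
      (forall a b, Delta a -> Delta b ->
         (sat (env (a ++ b)) (ieq Gam) <-> F a = F b)),
      (forall a b c, Delta a -> Delta b -> Delta c ->
         (sat (env (a ++ b ++ c)) (iadd Gam) <-> F a + F b = F c)) &
      (forall a b c, Delta a -> Delta b -> Delta c ->
         (sat (env (a ++ b ++ c)) (imul Gam) <-> F a * F b = F c))].

Arguments is_interpretation Gam {S} F.

Definition reduced (B : comNzRingType) : Prop :=
  forall b : B, (exists n : nat, b ^+ n = 0) -> b = 0.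

Definition indecomposable (B : comNzRingType) : Prop :=
  forall e : B, e * e = e -> e = 0 \/ e = 1.

Definition is_field (B : comNzRingType) : Prop :=
  forall b : B, b != 0 -> exists c : B, b * c = 1.

Definition infinite_mult_order (R : comNzRingType) (r : R) : Prop :=
  r != 0 /\ forall n : nat, (0 < n)%N -> r ^+ n != 1.

(* S is the polynomial ring over B in the indeterminates indexed by X, via
   the coefficient embedding iota and the indeterminates x: it is the free
   commutative B-algebra on X (universal property defining B[X] up to
   isomorphism). *)
Definition is_polynomial_ring (B : comNzRingType) (X : Type) (S : comNzRingType)
    (iota : {rmorphism B -> S}) (x : X -> S) : Prop :=
  forall (T : comNzRingType) (f : {rmorphism B -> T}) (g : X -> T),
    exists h : {rmorphism S -> T},
      [/\ (forall b, h (iota b) = f b),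
          (forall i, h (x i) = g i) &
          (forall h' : {rmorphism S -> T},
             (forall b, h' (iota b) = f b) -> (forall i, h' (x i) = g i) ->
             forall s, h' s = h s)].

Definition class1 (S : comNzRingType) : Prop :=
  exists (B : comNzRingType) (X : Type) (iota : {rmorphism B -> S}) (x : X -> S),
    [/\ is_polynomial_ring iota x, inhabited X,
        reduced B, indecomposable B & ~ is_field B].

Definition class2 (S : comNzRingType) : Prop :=
  exists (R : fieldType) (iota : {rmorphism R -> S}) (x : unit -> S),
    is_polynomial_ring iota x /\ exists r : R, infinite_mult_order r.

(* Main.v *)
(** In [S = A[x]] with [A] reduced and indecomposable, a divisor of [x^n] is a
    unit or a multiple of [x]; hence the powers of [x] are the [g] such that
    [x - 1 | g - 1] and every divisor of [g] is a unit or a multiple of [x].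
    Since [x^a - 1 | x^b - 1] iff [a | b], the relation [h = y^n] between
    [y = x^N], [x^n] and [h] is first order in [x], and then so is
    [g = p^n] for arbitrary [p]: it says that [x^N - p | x^(N n) - g] for all
    large [N].  The set of all pairs [(p^n, q^n)] is thus definable from the
    parameter [x].  The variable itself is not definable, but this set is the
    least one, among all those coded in the same way by arbitrary parameters
    [z], that contains (1, 1) and is closed under multiplication by [(p, q)];
    so it is definable without parameters.  The integer [m - n] is then
    represented by the triples [(p, p^m, p^n)] for any regular non-unit [p], and
    products come from [p^(m n) = (p^m)^n]. *)

Require Import Defs.
From HB Require Import structures.
From mathcomp Require Import all_boot all_order all_algebra.
From mathcomp Require Import zify ring.
From mathcomp Require Import boolp classical_sets.
Set Implicit Arguments. Unset Strict Implicit. Unset Printing Implicit Defensive.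
Import GRing.Theory.
Local Open Scope ring_scope.

(** * Polynomials over reduced rings *)

Section ReducedPolynomials.
Variable R : comNzRingType.
Hypothesis redR : forall a : R, a * a = 0 -> a = 0.
Implicit Types f g : {poly R}.

(* Multiply [(f g)_n = 0] by [f_k g_(n-k)]: only the square of the latter
   survives, the cross terms being [f_i g_(n-k) * f_k g_(n-i)]. *)
Lemma antidiagonal_eq0 f g n :
  (f * g)`_n = 0 ->
  (forall i k, (i < k <= n)%N -> (f`_i * g`_(n - k)) * (f`_k * g`_(n - i)) = 0) ->
  forall k, (k <= n)%N -> f`_k * g`_(n - k) = 0.
Proof.
move=> fg0 cross k lekn; apply: redR.
have kn : (k < n.+1)%N by [].
transitivity ((f * g)`_n * (f`_k * g`_(n - k))); last by rewrite fg0 mul0r.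
rewrite coefM mulr_suml (bigD1 (Ordinal kn)) //= big1 ?addr0 // => i neik.
have lein : (i <= n)%N by rewrite -ltnS.
have {neik} : (i : nat) != k by [].
rewrite neq_ltn => /orP[ltik|ltki].
  rewrite -[RHS](cross i k) ?ltik //; ring.
rewrite -[RHS](cross k i) ?ltki //; ring.
Qed.

(** Strong induction on [s = i + j]: for [a < b] the factor [f_a g_(s-b)] of a cross product has
    index sum below [s], so it is already known to vanish. *)
Lemma coef_mul_eq0_lower f g n :
  (forall s, (s < n)%N -> (f * g)`_s = 0) ->
  forall i j, (i + j < n)%N -> f`_i * g`_j = 0.
Proof.
move=> fg0 i j; move: {2}(i + j)%N (erefl (i + j)%N) => s.
elim/ltn_ind: s i j => s IH i j ijs ltn.
have -> : j = (s - i)%N by lia.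
apply: antidiagonal_eq0; [by apply: fg0; rewrite -ijs| |by lia].
move=> a b /andP[ltab lebs]; rewrite (IH (a + (s - b))%N) ?mul0r //; lia.
Qed.

(** Mirror image, descending from the sizes of [f] and [g]: now [f_b g_(s-a)], of larger index sum,
    vanishes. *)
Lemma coef_mul_eq0_upper f g n :
  (forall s, (n < s)%N -> (f * g)`_s = 0) ->
  forall i j, (n < i + j)%N -> f`_i * g`_j = 0.
Proof.
move=> fg0 i j.
have [m] := ubnP (size f + size g - (i + j))%N.
elim: m i j => // m IH i j lem ltn.
have [big|small] := leqP (size f + size g) (i + j).
  have [lefi|ltif] := leqP (size f) i; first by rewrite nth_default ?mul0r.
  have legj : (size g <= j)%N by lia.
  by rewrite (nth_default 0 legj) mulr0.
move: (erefl (i + j)%N); move: {2}(i + j)%N => s ijs.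
have -> : j = (s - i)%N by lia.
apply: antidiagonal_eq0; [by apply: fg0; rewrite -ijs| |by lia].
move=> a b /andP[ltab lebs]; rewrite (IH b (s - a)%N) ?mulr0 //; lia.
Qed.

Lemma coef_mulXn_eq0 f g n : f * g = 'X^n ->
  forall i j, (i + j != n)%N -> f`_i * g`_j = 0.
Proof.
move=> fgX i j; rewrite neq_ltn => /orP[ltn|gtn].
  by apply: (@coef_mul_eq0_lower f g n) ltn => s lt; rewrite fgX coefXn ltn_eqF.
by apply: (@coef_mul_eq0_upper f g n) gtn => s gt; rewrite fgX coefXn gtn_eqF.
Qed.

(** As [f_0 g_0 = 1], each higher [f_i] equals [f_0 (f_i g_0)], and [f_i g_0] vanishes because its
    index sum is not 0. *)
Lemma poly_unit_const f g : f * g = 1 -> f = (f`_0)%:P.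
Proof.
move=> fg1; have f0g0 : f`_0 * g`_0 = 1 by rewrite -coef0M fg1 coef1.
apply/polyP=> -[|i]; rewrite coefC //=.
rewrite -[f`_i.+1]mulr1 -f0g0 mulrCA.
by rewrite (@coef_mulXn_eq0 f g 0) ?mulr0 // fg1 expr0.
Qed.

(** In [f (1 - f) = 0] the product of the two [i]-th coefficients, for [i > 0], is [- f_i ^ 2]. *)
Lemma poly_idem_const f : f * f = f -> f = (f`_0)%:P.
Proof.
move=> ff; have f1f : f * (1 - f) = 0 by rewrite mulrBr mulr1 ff subrr.
apply/polyP=> -[|i]; rewrite coefC //=; apply: redR.
have := @coef_mul_eq0_lower f (1 - f) (i.+1 + i.+1).+1 _ i.+1 i.+1 (leqnn _).
rewrite f1f coefB coef1 /= sub0r mulrN => /(_ _)/eqP; rewrite oppr_eq0 => H.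
by apply/eqP/H => s _; rewrite coef0.
Qed.

(** All hinges on the idempotent [e = f_0 g_n]. If [e = 1], then [f] is the constant [f_0] with
    inverse [g_n]; if [e = 0], then [f_0] kills [g], hence ['X^n], so [f_0 = 0]. *)
Lemma divisor_Xn f g n : indecomposable R -> f * g = 'X^n ->
  (exists v, f * v = 1) \/ f`_0 = 0.
Proof.
move=> indR fgX; have fg0 := coef_mulXn_eq0 fgX.
pose e := f`_0 * g`_n.
have idem : e * e = e.
  (* Multiply the sum of the [f_i g_(n-i)], which is 1, by [e]: for [i > 0] the term contains
     [f_i g_n = 0], so only [e * e] is left. *)
  have : (f * g)`_n = 1 by rewrite fgX coefXn eqxx.
  rewrite coefM big_ord_recl subn0 /= -/e => sum1.
  rewrite -[RHS]mulr1 -sum1 mulrDr mulr_sumr big1 ?addr0 // => i _.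
  have nei : (bump 0 i + n != n)%N by rewrite /bump /=; lia.
  transitivity ((f`_(bump 0 i) * g`_n) * (f`_0 * g`_(n - bump 0 i))).
    by rewrite /e; ring.
  by rewrite fg0 ?mul0r.
case: (indR _ idem) => e01; last first.
  left; exists (g`_n)%:P; transitivity (e%:P); last by rewrite e01.
  rewrite /e rmorphM /=; congr (_ * _).
  apply/polyP=> -[|i]; rewrite coefC //=.
  rewrite -[f`_i.+1]mulr1 -e01 /e mulrCA fg0 ?mulr0 //; lia.
right; have f0g : f`_0 *: g = 0.
  apply/polyP=> j; rewrite coefZ coef0; have [->//|nejn] := eqVneq j n.
  by apply: fg0; rewrite add0n.
have : (f`_0 *: 'X^n : {poly R})`_n = 0 by rewrite -fgX scalerAr f0g mulr0 coef0.
by rewrite coefZ coefXn eqxx mulr1.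
Qed.

End ReducedPolynomials.

(** Restricting reducedness to a set [P] of coefficients prepares an induction over the variables.
    Once all [f_j] with [j < i] vanish, [f * f] has coefficient [f_i ^ 2] in degree [2 i]. *)
Lemma sqr_poly_eq0 (R : comNzRingType) (P : R -> Prop) (f : {poly R}) :
  (forall a, P a -> a * a = 0 -> a = 0) -> (forall i, P f`_i) ->
  f * f = 0 -> f = 0.
Proof.
move=> redP Pf ff0; apply/polyP=> i; rewrite coef0.
elim/ltn_ind: i => i IH; apply: redP => //.
have lti : (i < (i + i).+1)%N by lia.
have := congr1 (fun q : {poly R} => q`_(i + i)) ff0.
rewrite coef0 coefM (bigD1 (Ordinal lti)) //= addnK big1 ?addr0 // => j neji.
have {neji} : (j : nat) != i by [].
rewrite neq_ltn => /orP[ltji|ltij]; first by rewrite IH ?mul0r.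
by rewrite (IH (i + i - j)%N) ?mulr0 //; move: (ltn_ord j); lia.
Qed.

(** * Divisibility by monic polynomials *)

Section MonicDivision.
Variable R : comNzRingType.
Implicit Types f g : {poly R}.

Lemma monic_dvd_small f g q :
  f \is monic -> f * q = g -> (size g < size f)%N -> g = 0.
Proof.
move=> monf <-; have [->|q0] := eqVneq q 0; first by rewrite mulr0.
rewrite size_monicM // -subn1.
have := size_poly_eq0 q; rewrite (negPf q0); lia.
Qed.

(** For [m > 0] write [n = k m + r] with [r < m]: then ['X^m - 1] divides ['X^r - 1], which is too
    small to be a nonzero multiple of it. *)
Lemma dvd_Xn1 m n q : ('X^m - 1) * q = 'X^n - 1 :> {poly R} -> (m %| n)%N.
Proof.
case: m => [|m].
  rewrite expr0 subrr mul0r => /eqP; rewrite eq_sym subr_eq0 => /eqP E.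
  have := congr1 (fun p : {poly R} => size p) E.
  by rewrite size_polyXn size_poly1 dvd0n => -[->].
rewrite {1}(divn_eq n m.+1) exprD.
set k := (n %/ _)%N; set r := (n %% _)%N => E.
have rlt : (r < m.+1)%N by rewrite ltn_mod.
have : ('X^(m.+1) - 1) * (q - 'X^r * \sum_(i < k) 'X^(m.+1) ^+ i) = 'X^r - 1
    :> {poly R}.
  rewrite mulrBr E mulrCA -subrX1 -exprM [(m.+1 * k)%N]mulnC; ring.
have szX j : (0 < j)%N -> size ('X^j - 1 : {poly R}) = j.+1.
  by move=> j0; rewrite size_XnsubC.
move/monic_dvd_small => H.
case: (posnP r) => [r0|r0]; first exact/eqP.
have /eqP : 'X^r - 1 = 0 :> {poly R}.
  by apply: H; rewrite ?monicXnsubC // ?szX.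
by rewrite -size_poly_eq0 szX.
Qed.

Lemma Xn_dvd_leq m n q : 'X^m * q = 'X^n :> {poly R} -> (m <= n)%N.
Proof.
move/(congr1 (fun p : {poly R} => size p)).
have [->|q0] := eqVneq q 0; first by rewrite mulr0 size_poly0 size_polyXn.
rewrite size_monicM ?monicXn // !size_polyXn.
have := size_poly_eq0 q; rewrite (negPf q0); lia.
Qed.

End MonicDivision.

(** * Definability from the variable *)

Section FirstOrderRelations.
Variable S : comNzRingType.
Implicit Types a b d g h k p q x y z : S.

Definition divides a b := exists c, a * c = b.

Definition logpow y g :=
  divides (y - 1) (g - 1) /\
  forall d, divides d g -> divides d 1 \/ divides y d.

(* For [z = x], [y = x^N], [k = x^n] with [n <= N], the candidates are the
   [h = x^(N t)] with [t = n %[mod N.+1]], the least of which is [y^n]. *)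
Definition candidate z y k h :=
  [/\ logpow z h, divides (y - 1) (h - 1) & divides (y * z - 1) (h * k - 1)].

Definition least_candidate z y k h :=
  candidate z y k h /\ forall h', candidate z y k h' -> divides h h'.

Definition exp_code z k p g :=
  forall y h, logpow z y -> divides k y -> least_candidate z y k h ->
  divides (y - p) (h - g).

Definition same_exp_code z p q g h :=
  exists k, [/\ logpow z k, exp_code z k p g & exp_code z k q h].

Definition inductive_code z p q :=
  same_exp_code z p q 1 1 /\
  forall a b, same_exp_code z p q a b -> same_exp_code z p q (p * a) (q * b).

(* The least set of pairs containing (1, 1) and closed under multiplication by
   (p, q), where "least" is taken among the sets coded by some [z]. *)
Definition same_exp p q g h :=
  forall z, inductive_code z p q -> same_exp_code z p q g h.

Lemma dividesB d a b : divides d a -> divides d b -> divides d (a - b).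
Proof. by move=> [u <-] [v <-]; exists (u - v); rewrite mulrBr. Qed.

Lemma divides_exp a m n : (m <= n)%N -> divides (a ^+ m) (a ^+ n).
Proof. by move=> lemn; exists (a ^+ (n - m)); rewrite -exprD subnKC. Qed.

Lemma divides_subX a b n : divides (a - b) (a ^+ n - b ^+ n).
Proof. by rewrite subrXX; eexists. Qed.

Lemma divides_subX1 a m n : (m %| n)%N -> divides (a ^+ m - 1) (a ^+ n - 1).
Proof.
by case/dvdnP=> k ->; rewrite mulnC exprM -{2}(expr1n S k); exact: divides_subX.
Qed.

End FirstOrderRelations.

Lemma divides_rmorph (R S : comNzRingType) (f : {rmorphism R -> S}) a b :
  divides a b -> divides (f a) (f b).
Proof. by case=> c <-; exists (f c); rewrite rmorphM. Qed.

(** * Elements that behave like a polynomial variable *)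

Section PolynomialVariable.
(** [h] expands an element in powers of [x]; keeping the coefficients in [S] avoids naming a subring
    of them. *)
Variables (S : comNzRingType) (x : S) (h : {rmorphism S -> {poly S}}).
Hypothesis redS : forall a : S, a * a = 0 -> a = 0.
Hypothesis indS : indecomposable S.
Hypothesis hx : h x = 'X.
Hypothesis hK : forall s, (h s).[x] = s.

Lemma expansion_inj : injective h.
Proof. by move=> s t E; rewrite -[s]hK -[t]hK E. Qed.

Lemma expansionX n : h (x ^+ n) = 'X^n.
Proof. by rewrite rmorphXn /= hx. Qed.

Lemma divides_varX_leq m n : divides (x ^+ m) (x ^+ n) -> (m <= n)%N.
Proof.
by move/(divides_rmorph h) => [q]; rewrite !expansionX; exact: Xn_dvd_leq.
Qed.

Lemma divides_varX1 m n : divides (x ^+ m - 1) (x ^+ n - 1) -> (m %| n)%N.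
Proof.
move/(divides_rmorph h) => [q]; rewrite !rmorphB !expansionX rmorph1.
exact: dvd_Xn1.
Qed.

Lemma var_not_unit : ~ divides x 1.
Proof. by move/(@divides_varX_leq 1 0). Qed.

Lemma var_regular a : x * a = 0 -> a = 0.
Proof.
move/(congr1 h); rewrite rmorphM rmorph0 hx => xa0.
apply: expansion_inj; rewrite rmorph0; apply/polyP=> i.
by have := coefXM (h a) i.+1; rewrite xa0 !coef0.
Qed.

Lemma var_factorization g : g != 0 ->
  exists m g', g = x ^+ m * g' /\ ~ divides x g'.
Proof.
have [m] := ubnP (size (h g)); elim: m g => // m IH g lem g0.
have [[g1 xg1]|ndiv] := pselect (divides x g); last first.
  by exists 0%N, g; rewrite expr0 mul1r.
have g10 : g1 != 0 by apply: contraNneq g0 => g10; rewrite -xg1 g10 mulr0.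
have hg10 : h g1 != 0.
  by apply: contraNneq g10 => E; apply/eqP/expansion_inj; rewrite E rmorph0.
have [|//|k [g' [Eg1 nd]]] := IH g1.
  by move: lem; rewrite -xg1 rmorphM hx mulrC size_mulX.
by exists k.+1, g'; rewrite -xg1 {1}Eg1 exprS mulrA.
Qed.

Lemma specialization c :
  exists e : {rmorphism S -> S}, e x = c /\ forall s, e s = (h s).[c].
Proof.
exists (horner_eval c \o h); split=> //=.
by rewrite hx /horner_eval hornerX.
Qed.

Lemma logpow_var g : logpow x g <-> exists n, g = x ^+ n.
Proof.
split=> [[x1g divg]|[n ->]]; last first.
  split=> [|d [c dc]]; first by rewrite -{2}(expr1n S n); exact: divides_subX.
  have /(divisor_Xn redS indS) : h d * h c = 'X^n by rewrite -rmorphM dc expansionX.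
  case=> [[v dv]|d0].
    by left; exists v.[x]; rewrite -{1}(hK d) -hornerM dv hornerE.
  right; have /factor_theorem[v dv] : root (h d) 0.
    by rewrite /root horner_coef0 d0.
  by exists v.[x]; rewrite -[RHS]hK dv !hornerE mulrC subr0.
(* If [g = 0], then [x - 1] divides it and would be a unit or a multiple of [x]; putting [x = 1],
   respectively [x = 0], refutes this. *)
have g0 : g != 0.
  apply/eqP=> g0.
  have [|[v E]|[v E]] := divg (x - 1); first by exists 0; rewrite mulr0 g0.
    have [e [ex _]] := specialization 1; move/(congr1 e): E.
    rewrite rmorphM rmorphB rmorph1 ex subrr mul0r => /eqP.
    by rewrite eq_sym oner_eq0.
  have [e [ex _]] := specialization 0; move/(congr1 e): E.
  rewrite rmorphM rmorphB rmorph1 ex mul0r sub0r => /eqP.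
  by rewrite eq_sym oppr_eq0 oner_eq0.
(* Here [g'] is a unit, so its expansion is constant, and putting [x = 1] in
   [divides (x - 1) (g - 1)] yields [g' = 1]. *)
have [m [g' [Eg ndiv]]] := var_factorization g0.
have [|[v g'v]|/ndiv//] := divg g'; first by exists (x ^+ m); rewrite mulrC -Eg.
exists m; suff g'1 : g' = 1 by rewrite Eg g'1 mulr1.
have cst : h g' = ((h g')`_0)%:P.
  by apply: (@poly_unit_const S redS _ (h v)); rewrite -rmorphM g'v rmorph1.
have g'E : g' = (h g')`_0 by rewrite -[LHS]hK {1}cst hornerC.
have [e [ex eE]] := specialization 1.
have eg' : e g' = g' by rewrite eE cst hornerC -g'E.
have [q] := divides_rmorph e x1g.
rewrite Eg !rmorphB rmorphM rmorphXn rmorph1 ex eg' subrr mul0r expr1n mul1r.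
by move/eqP; rewrite eq_sym subr_eq0 => /eqP.
Qed.

Lemma logpow_varX n : logpow x (x ^+ n).
Proof. by apply/logpow_var; exists n. Qed.

Lemma candidate_expX N n : candidate x (x ^+ N) (x ^+ n) (x ^+ (N * n)).
Proof.
split; first exact: logpow_varX.
  by apply: divides_subX1; exact: dvdn_mulr.
by rewrite -exprSr -exprD -mulSnr; apply: divides_subX1; exact: dvdn_mulr.
Qed.

(** Here [m = t N], and [N + 1] divides [m + n = t (N + 1) + (n - t)]; for [t < n] it would divide
    [n - t], which lies strictly between 0 and [N + 1]. *)
Lemma candidate_var_geq N n h' : (n <= N)%N ->
  candidate x (x ^+ N) (x ^+ n) h' ->
  exists2 m, h' = x ^+ m & (N * n <= m)%N.
Proof.
move=> lenN [/logpow_var[m ->] /divides_varX1 /dvdnP[t Em]].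
rewrite -exprSr -exprD => /divides_varX1; exists m => //.
rewrite Em mulnC leq_mul2r; apply/orP; right; rewrite leqNgt; apply/negP=> lttn.
have : (N.+1 %| t * N.+1 + (n - t))%N.
  by have -> : (t * N.+1 + (n - t) = m + n)%N by lia.
rewrite dvdn_addr ?dvdn_mull // => /dvdn_leq; lia.
Qed.

Lemma least_candidate_expX N n h' : (n <= N)%N ->
  least_candidate x (x ^+ N) (x ^+ n) h' <-> h' = x ^+ (N * n).
Proof.
move=> lenN; split=> [[ch' least]|->]; last first.
  split=> [|h'' /(candidate_var_geq lenN)[m -> le]]; first exact: candidate_expX.
  exact: divides_exp.
have [m Em le] := candidate_var_geq lenN ch'.
have := least _ (candidate_expX N n); rewrite Em => /divides_varX_leq le'.
by congr (_ ^+ _); apply/eqP; rewrite eqn_leq le'.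
Qed.

(* Modulo [x^N - p] one has [x^(N n) = p^n]; once [N] exceeds the degrees of
   [g] and [p^n] this congruence is an equality. *)
Lemma exp_code_var n p g : exp_code x (x ^+ n) p g <-> g = p ^+ n.
Proof.
split=> [code|-> y h' /logpow_var[N ->] /divides_varX_leq lenN]; last first.
  move/(least_candidate_expX _ lenN) ->; rewrite exprM; exact: divides_subX.
(* The summands ensure, in order, that [x^n] divides [x^N], that ['X^N - h p] is monic of size
   [N + 1], and that [h (p^n - g)] is too small to be a nonzero multiple of it. *)
pose N := (n + size (h p) + size (h (p ^+ n - g)%R))%N.
have lenN : (n <= N)%N by rewrite /N; lia.
have dvd1 : divides (x ^+ N - p) (x ^+ (N * n) - g).
  apply: code; [exact: logpow_varX|exact: divides_exp|].
  exact/least_candidate_expX.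
have dvd2 : divides (x ^+ N - p) (x ^+ (N * n) - p ^+ n).
  by rewrite exprM; exact: divides_subX.
have := dividesB dvd1 dvd2.
have -> : x ^+ (N * n) - g - (x ^+ (N * n) - p ^+ n) = p ^+ n - g by ring.
move=> /(divides_rmorph h)[q].
rewrite rmorphB expansionX => E.
have ltp : (size (- h p) < size ('X^N : {poly S}))%N.
  rewrite size_polyN size_polyXn ltnS.
  exact: leq_trans (leq_addl _ _) (leq_addr _ _).
have : h (p ^+ n - g) = 0.
  apply: monic_dvd_small E _.
    by rewrite monicE lead_coefDl // lead_coefXn.
  by rewrite size_polyDl // size_polyXn ltnS leq_addl.
by rewrite -(rmorph0 h) => /expansion_inj /eqP; rewrite subr_eq0 => /eqP.
Qed.

Lemma same_exp_code_var p q g g' :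
  same_exp_code x p q g g' <-> exists n, g = p ^+ n /\ g' = q ^+ n.
Proof.
split=> [[k []]|[n [-> ->]]].
  by move=> /logpow_var[n ->] /exp_code_var Eg /exp_code_var Eg'; exists n.
by exists (x ^+ n); split; [exact: logpow_varX|exact/exp_code_var..].
Qed.

Lemma same_expP (p q g g' : S) :
  same_exp p q g g' <-> exists n, g = p ^+ n /\ g' = q ^+ n.
Proof.
split=> [se|[n [-> ->]] z [base step]]; last first.
  by elim: n => [//|n IH]; rewrite !exprS; exact: step.
apply/same_exp_code_var/se; split.
  by apply/same_exp_code_var; exists 0%N.
move=> a b /same_exp_code_var[n [-> ->]]; apply/same_exp_code_var.
by exists n.+1; rewrite !exprS.
Qed.

End PolynomialVariable.

(** * Polynomial rings from their universal property *)

Section SubringType.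
Variables (S : comNzRingType) (P : {pred S}).

(** Carrying the closure proof as an argument lets the subring structure be inferred from the
    predicate. *)
Definition subring_pred of GRing.subring_closed P := P.

Variable subP : GRing.subring_closed P.

HB.instance Definition _ :=
  GRing.isSubringClosed.Build S (subring_pred subP) subP.

Record subring := Subring { subring_val : S; _ : subring_val \in subring_pred subP }.

HB.instance Definition _ := [isSub for subring_val].
HB.instance Definition _ := [Choice of subring by <:].
HB.instance Definition _ := [SubChoice_isSubComNzRing of subring by <:].

Lemma corestrict_rmorphism (R : comNzRingType) (f : {rmorphism R -> S}) :
  (forall r, f r \in P) ->
  exists f' : {rmorphism R -> subring}, forall r, val (f' r) = f r.
Proof.
move=> fP; pose f0 r : subring := Subring (fP r : f r \in subring_pred subP).
have f0A : GRing.zmod_morphism f0.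
  by move=> r s; apply: val_inj; rewrite rmorphB /= rmorphB.
have f0M : GRing.monoid_morphism f0.
  by split=> [|r s]; apply: val_inj; rewrite ?rmorph1 ?rmorphM /= ?rmorph1 ?rmorphM.
pose f' : {rmorphism R -> subring} :=
  HB.pack f0 (GRing.isZmodMorphism.Build R subring f0 f0A)
             (GRing.isMonoidMorphism.Build R subring f0 f0M).
by exists f'.
Qed.

End SubringType.

Section PolynomialRing.
Variables (B : comNzRingType) (X : eqType) (S : comNzRingType).
Variables (iota : {rmorphism B -> S}) (x : X -> S).
Hypothesis polyS : is_polynomial_ring iota x.

Definition extend (T : comNzRingType) (f : {rmorphism B -> T}) (g : X -> T) :
  {rmorphism S -> T} := projT1 (cid (polyS f g)).

Lemma extend_coef (T : comNzRingType) (f : {rmorphism B -> T}) g b :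
  extend f g (iota b) = f b.
Proof. by rewrite /extend; case: cid => h []. Qed.

Lemma extend_var (T : comNzRingType) (f : {rmorphism B -> T}) g i :
  extend f g (x i) = g i.
Proof. by rewrite /extend; case: cid => h []. Qed.

Lemma rmorphism_ext (T : comNzRingType) (f g : {rmorphism S -> T}) :
  (forall b, f (iota b) = g (iota b)) -> (forall i, f (x i) = g (x i)) -> f =1 g.
Proof.
move=> fgb fgx s; have [h [_ _ uniq]] := polyS (g \o iota) (g \o x).
by rewrite (uniq f) // (uniq g).
Qed.

(** The elements satisfying [P] form a subring containing the generators. The map into it given by
    the universal property, followed by the inclusion, is the identity by uniqueness. *)
Lemma polynomial_ring_ind (P : S -> Prop) :
  (forall b, P (iota b)) -> (forall i, P (x i)) ->
  (forall s t, P s -> P t -> P (s - t)) ->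
  (forall s t, P s -> P t -> P (s * t)) ->
  forall s, P s.
Proof.
move=> Pb Px PB PM s; pose Q : {pred S} := fun s => `[< P s >].
have subQ : GRing.subring_closed Q.
  split; first by apply/asboolP; rewrite -(rmorph1 iota).
    by move=> u v /asboolP Pu /asboolP Pv; apply/asboolP; exact: PB.
  by move=> u v /asboolP Pu /asboolP Pv; apply/asboolP; exact: PM.
have iotaQ b : iota b \in Q by exact/asboolP.
have [f fE] := corestrict_rmorphism subQ iotaQ.
have xQ i : x i \in subring_pred subQ by exact/asboolP.
pose e := extend f (fun i => Subring (xQ i)).
have -> : s = val (e s).
  pose v : {rmorphism subring subQ -> S} := val.
  apply: (@rmorphism_ext _ idfun (v \o e)) => [b|i] /=.
    by rewrite /e extend_coef fE.
  by rewrite /e extend_var.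
by apply/asboolP; exact: valP (e s).
Qed.

Definition expansion i : {rmorphism S -> {poly S}} :=
  extend (polyC \o iota) (fun j => if j == i then 'X else (x j)%:P).

Lemma expansion_var i : expansion i (x i) = 'X.
Proof. by rewrite /expansion extend_var eqxx. Qed.

Lemma expansion_eval i s : (expansion i s).[x i] = s.
Proof.
apply: (@rmorphism_ext _ (horner_eval (x i) \o expansion i) idfun) => [b|j] /=.
  by rewrite /expansion extend_coef /horner_eval hornerC.
rewrite /expansion extend_var /horner_eval.
by case: eqP => [->|_]; rewrite ?hornerX ?hornerC.
Qed.

Definition augmentation : {rmorphism S -> B} := extend idfun (fun=> 0).

(** The equation [retraction l s = s] serves to say that [s] involves only indeterminates from
    [l]. *)
Definition retraction (l : seq X) : {rmorphism S -> S} :=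
  extend iota (fun i => if i \in l then x i else 0).

Lemma retraction_nil s : retraction [::] s = iota (augmentation s).
Proof.
apply: (@rmorphism_ext _ (retraction [::]) (iota \o augmentation)) => [b|i] /=.
  by rewrite /retraction /augmentation !extend_coef.
by rewrite /retraction /augmentation !extend_var rmorph0.
Qed.

(** Hence if [s] involves only indeterminates from [i :: l], its coefficients as a polynomial in
    [x i] involve only those from [l]. *)
Lemma expansion_retraction i l s :
  expansion i (retraction (i :: l) s) = map_poly (retraction l) (expansion i s).
Proof.
apply: (@rmorphism_ext _ (expansion i \o retraction (i :: l))
  (map_poly (retraction l) \o expansion i)) => [b|j] /=.
  by rewrite /expansion /retraction !extend_coef /= map_polyC /= extend_coef.
rewrite {1}/retraction extend_var inE /expansion.
have [->|neji] /= := eqVneq j i; first by rewrite !extend_var eqxx map_polyX.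
rewrite !extend_var (negPf neji) map_polyC /= extend_var.
by case: ifP; rewrite ?extend_var ?(negPf neji) ?rmorph0.
Qed.

(** Allowing every larger [l'] makes it possible to concatenate the supports of two elements. *)
Lemma finite_support s :
  exists l : seq X, forall l', {subset l <= l'} -> retraction l' s = s.
Proof.
elim/polynomial_ring_ind: s => [b|i|s t|s t].
- by exists [::] => l' _; rewrite /retraction extend_coef.
- exists [:: i] => l' sub.
  by rewrite /retraction extend_var (sub i) // mem_head.
- move=> [l1 H1] [l2 H2]; exists (l1 ++ l2) => l' sub.
  by rewrite rmorphB H1 ?H2 // => i il; apply: sub; rewrite mem_cat il ?orbT.
move=> [l1 H1] [l2 H2]; exists (l1 ++ l2) => l' sub.
by rewrite rmorphM H1 ?H2 // => i il; apply: sub; rewrite mem_cat il ?orbT.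
Qed.

(** Induction on a finite support: if it is empty, [s] is a constant from [B]; otherwise [s] is
    expanded in one variable, and its coefficients are supported on the shorter list. *)
Lemma polynomial_ring_sqr_eq0 (s : S) : reduced B -> s * s = 0 -> s = 0.
Proof.
move=> redB; have [l /(_ l (fun=> id))] := finite_support s.
elim: l s => [|i l IH] s sl ss0.
  move: sl ss0; rewrite retraction_nil => <-.
  move/(congr1 augmentation); rewrite rmorphM rmorph0 /augmentation extend_coef /=.
  rewrite -/augmentation => ss0.
  by rewrite (redB (augmentation s)) ?rmorph0 //; exists 2%N.
rewrite -(expansion_eval i s).
rewrite (@sqr_poly_eq0 _ (fun a => retraction l a = a) (expansion i s)) ?horner0 //.
  by move=> j; rewrite -{2}sl expansion_retraction coef_map.
by rewrite -rmorphM ss0 rmorph0.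
Qed.

(* Along [x_i |-> x_i t], idempotents go to idempotents of S[t], which are
   constant; compare the values at [t = 1] and [t = 0]. *)
Lemma polynomial_ring_indecomposable :
  reduced B -> indecomposable B -> indecomposable S.
Proof.
move=> redB indB e ee.
pose scale := extend (polyC \o iota) (fun i => (x i)%:P * 'X).
have scale1 s : (scale s).[1] = s.
  apply: (@rmorphism_ext _ (horner_eval 1 \o scale) idfun) => [b|i] /=.
    by rewrite /scale extend_coef /horner_eval hornerC.
  by rewrite /scale extend_var /horner_eval hornerMX hornerC mulr1.
have scale0 s : (scale s).[0] = iota (augmentation s).
  apply: (@rmorphism_ext _ (horner_eval 0 \o scale) (iota \o augmentation)) => [b|i] /=.
    by rewrite /scale extend_coef /horner_eval hornerC /augmentation extend_coef.
  by rewrite /scale !extend_var /horner_eval hornerMX mulr0 rmorph0.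
have redS a : a * a = 0 -> a = 0 := @polynomial_ring_sqr_eq0 a redB.
have cst : scale e = ((scale e)`_0)%:P.
  by apply: poly_idem_const => //; rewrite -rmorphM ee.
have -> : e = iota (augmentation e) by rewrite -scale0 -[LHS]scale1 cst !hornerC.
have [|->|->] := indB (augmentation e); first by rewrite -rmorphM ee.
  by left; rewrite rmorph0.
by right; rewrite rmorph1.
Qed.

End PolynomialRing.

(** * Formulas *)

(* A formula builder with first argument [k] binds only variables from [k] on,
   so it does not capture variables of terms that are [below k]. *)
Fixpoint below (k : nat) (t : term) : Prop :=
  match t with
  | TVar i => (i < k)%N
  | TZero | TOne => True
  | TAdd t1 t2 | TMul t1 t2 => below k t1 /\ below k t2
  | TNeg t1 => below k t1
  end.

Lemma belowS k t : below k t -> below k.+1 t.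
Proof.
elim: t => //= [i /leqW //|t1 IH1 t2 IH2 [] /IH1 ? /IH2 //|t1 IH1 t2 IH2].
by case=> /IH1 ? /IH2.
Qed.

Ltac below_tac := simpl; repeat split; auto 10 using belowS, leqW, ltnSn.

Definition tsub s t := TAdd s (TNeg t).
Definition fimp p q := FOr (FNot p) q.

Definition fdivides k s t := FEx k (FEq (TMul s (TVar k)) t).

Definition flogpow k y g :=
  FAnd (fdivides k (tsub y TOne) (tsub g TOne))
    (FAll k (fimp (fdivides k.+1 (TVar k) g)
       (FOr (fdivides k.+1 (TVar k) TOne) (fdivides k.+1 y (TVar k))))).

Definition fcandidate k z y c h :=
  FAnd (flogpow k z h)
    (FAnd (fdivides k (tsub y TOne) (tsub h TOne))
          (fdivides k (tsub (TMul y z) TOne) (tsub (TMul h c) TOne))).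

Definition fleast_candidate k z y c h :=
  FAnd (fcandidate k z y c h)
    (FAll k (fimp (fcandidate k.+1 z y c (TVar k)) (fdivides k.+1 h (TVar k)))).

Definition fexp_code k z c p g :=
  FAll k (FAll k.+1 (
    fimp (flogpow k.+2 z (TVar k))
      (fimp (fdivides k.+2 c (TVar k))
        (fimp (fleast_candidate k.+2 z (TVar k) c (TVar k.+1))
          (fdivides k.+2 (tsub (TVar k) p) (tsub (TVar k.+1) g)))))).

Definition fsame_exp_code k z p q g h :=
  FEx k (FAnd (flogpow k.+1 z (TVar k))
    (FAnd (fexp_code k.+1 z (TVar k) p g) (fexp_code k.+1 z (TVar k) q h))).

Definition finductive_code k z p q :=
  FAnd (fsame_exp_code k z p q TOne TOne)
    (FAll k (FAll k.+1 (
      fimp (fsame_exp_code k.+2 z p q (TVar k) (TVar k.+1))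
        (fsame_exp_code k.+2 z p q (TMul p (TVar k)) (TMul q (TVar k.+1)))))).

Definition fsame_exp k p q g h :=
  FAll k (fimp (finductive_code k.+1 (TVar k) p q)
    (fsame_exp_code k.+1 (TVar k) p q g h)).

Section Satisfaction.
Variable S : comNzRingType.
Implicit Types (v : nat -> S) (k : nat).

Lemma teval_upd v k a t : below k t -> teval (upd v k a) t = teval v t.
Proof.
elim: t => //= [i ltik|t1 IH1 t2 IH2 [/IH1-> /IH2->]|t1 IH1 /IH1->|
  t1 IH1 t2 IH2 [/IH1-> /IH2->]] //.
by rewrite /upd ltn_eqF.
Qed.

Lemma teval_upd_var v k a : teval (upd v k a) (TVar k) = a.
Proof. by rewrite /= /upd eqxx. Qed.

Lemma sat_and v p q (P Q : Prop) :
  sat v p = P -> sat v q = Q -> sat v (FAnd p q) = (P /\ Q).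
Proof. by move=> <- <-. Qed.

Lemma sat_or v p q : sat v (FOr p q) = (sat v p \/ sat v q).
Proof. by []. Qed.

Lemma sat_not v p P : sat v p = P -> sat v (FNot p) = ~ P.
Proof. by move=> <-. Qed.

Lemma sat_eq v s t : sat v (FEq s t) = (teval v s = teval v t).
Proof. by []. Qed.

Lemma sat_imp v p q : sat v (fimp p q) = (sat v p -> sat v q).
Proof. by rewrite implyE. Qed.

Lemma sat_all v k p (P : S -> Prop) :
  (forall a, sat (upd v k a) p = P a) -> sat v (FAll k p) = forall a, P a.
Proof. exact: eq_forall. Qed.

Lemma sat_ex v k p (P : S -> Prop) :
  (forall a, sat (upd v k a) p = P a) -> sat v (FEx k p) = exists a, P a.
Proof. exact: eq_exists. Qed.

Lemma and3E (P Q R : Prop) : [/\ P, Q & R] = (P /\ Q /\ R).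
Proof. by rewrite propeqE; split=> [[]|[? []]]. Qed.

Lemma teval_sub v s t : teval v (tsub s t) = teval v s - teval v t.
Proof. by []. Qed.

Lemma teval_mul v s t : teval v (TMul s t) = teval v s * teval v t.
Proof. by []. Qed.

Lemma teval_one v : teval v TOne = 1.
Proof. by []. Qed.

Lemma teval_zero v : teval v TZero = 0.
Proof. by []. Qed.

Definition teval_simpl :=
  (teval_upd_var, teval_sub, teval_mul, teval_one, teval_zero, teval_upd).

Lemma sat_divides v k s t : below k s -> below k t ->
  sat v (fdivides k s t) = divides (teval v s) (teval v t).
Proof.
move=> ks kt; apply: sat_ex => a.
by rewrite /= !teval_upd // /upd eqxx.
Qed.

Lemma sat_logpow v k y g : below k y -> below k g ->
  sat v (flogpow k y g) = logpow (teval v y) (teval v g).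
Proof.
move=> ky kg; apply: sat_and; first by rewrite sat_divides; below_tac.
apply: sat_all => d.
rewrite sat_imp sat_or !sat_divides; [|by below_tac..].
by rewrite !teval_simpl; [|by below_tac..].
Qed.

Lemma sat_candidate v k z y c h :
  below k z -> below k y -> below k c -> below k h ->
  sat v (fcandidate k z y c h) =
  candidate (teval v z) (teval v y) (teval v c) (teval v h).
Proof.
move=> kz ky kc kh; rewrite /candidate and3E.
apply: sat_and; [by rewrite sat_logpow|apply: sat_and];
  by rewrite sat_divides; below_tac.
Qed.

Lemma sat_least_candidate v k z y c h :
  below k z -> below k y -> below k c -> below k h ->
  sat v (fleast_candidate k z y c h) =
  least_candidate (teval v z) (teval v y) (teval v c) (teval v h).
Proof.
move=> kz ky kc kh; apply: sat_and; first by rewrite sat_candidate.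
apply: sat_all => h'.
rewrite sat_imp sat_candidate ?sat_divides; [|by below_tac..].
by rewrite !teval_simpl; [|by below_tac..].
Qed.

Lemma sat_exp_code v k z c p g :
  below k z -> below k c -> below k p -> below k g ->
  sat v (fexp_code k z c p g) =
  exp_code (teval v z) (teval v c) (teval v p) (teval v g).
Proof.
move=> kz kc kp kg; apply: sat_all => y; apply: sat_all => h.
rewrite !sat_imp sat_logpow ?sat_least_candidate ?sat_divides; [|by below_tac..].
by rewrite !teval_simpl; [|by below_tac..].
Qed.

Lemma sat_same_exp_code v k z p q g h :
  below k z -> below k p -> below k q -> below k g -> below k h ->
  sat v (fsame_exp_code k z p q g h) =
  same_exp_code (teval v z) (teval v p) (teval v q) (teval v g) (teval v h).
Proof.
move=> kz kp kq kg kh; apply: sat_ex => c; rewrite and3E.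
apply: sat_and; [|apply: sat_and]; rewrite ?sat_logpow ?sat_exp_code;
  try (by below_tac); by rewrite !teval_simpl; [|by below_tac..].
Qed.

Lemma sat_inductive_code v k z p q :
  below k z -> below k p -> below k q ->
  sat v (finductive_code k z p q) =
  inductive_code (teval v z) (teval v p) (teval v q).
Proof.
move=> kz kp kq; apply: sat_and; first by rewrite sat_same_exp_code; below_tac.
apply: sat_all => a; apply: sat_all => b.
rewrite sat_imp !sat_same_exp_code; [|by below_tac..].
by rewrite !teval_simpl; [|by below_tac..].
Qed.

Lemma sat_same_exp v k p q g h :
  below k p -> below k q -> below k g -> below k h ->
  sat v (fsame_exp k p q g h) =
  same_exp (teval v p) (teval v q) (teval v g) (teval v h).
Proof.
move=> kp kq kg kh; apply: sat_all => z.
rewrite sat_imp sat_inductive_code ?sat_same_exp_code; [|by below_tac..].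
by rewrite !teval_simpl; [|by below_tac..].
Qed.

End Satisfaction.

(** * The interpretation *)

Definition interp_dom k p a b :=
  FAnd (FAll k (fimp (FEq (TMul p (TVar k)) TZero) (FEq (TVar k) TZero)))
    (FAnd (FNot (fdivides k p TOne))
      (FAnd (fsame_exp k p p a a) (fsame_exp k p p b b))).

(** For [a = p^m], [b = p^n], [c = q^m'], [d = q^n'], the exponents of [c] and [d] are carried over
    to base [p], where [m - n = m' - n'] is tested as [m + n' = n + m']. *)
Definition interp_eq k p a b q c d :=
  FEx k (FEx k.+1 (
    FAnd (fsame_exp k.+2 q p c (TVar k))
      (FAnd (fsame_exp k.+2 q p d (TVar k.+1))
        (FEq (TMul a (TVar k.+1)) (TMul b (TVar k)))))).

Definition interp_add k p a b q c d r e f :=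
  FEx k (FEx k.+1 (FEx k.+2 (FEx k.+3 (
    FAnd (FAnd (fsame_exp k.+4 q p c (TVar k)) (fsame_exp k.+4 q p d (TVar k.+1)))
      (FAnd (FAnd (fsame_exp k.+4 r p e (TVar k.+2))
                  (fsame_exp k.+4 r p f (TVar k.+3)))
        (FEq (TMul (TMul a (TVar k)) (TVar k.+3))
             (TMul (TMul b (TVar k.+1)) (TVar k.+2)))))))).

Definition interp_mul k p a b q c d r e f :=
  FEx k (FEx k.+1 (FEx k.+2 (FEx k.+3 (FEx k.+4 (FEx k.+4.+1 (
    FAnd (FAnd (FAnd (fsame_exp k.+4.+2 q a c (TVar k))
                     (fsame_exp k.+4.+2 q b d (TVar k.+1)))
               (FAnd (fsame_exp k.+4.+2 q a d (TVar k.+2))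
                     (fsame_exp k.+4.+2 q b c (TVar k.+3))))
      (FAnd (FAnd (fsame_exp k.+4.+2 r p e (TVar k.+4))
                  (fsame_exp k.+4.+2 r p f (TVar k.+4.+1)))
        (FEq (TMul (TMul (TVar k) (TVar k.+1)) (TVar k.+4.+1))
             (TMul (TMul (TVar k.+2) (TVar k.+3)) (TVar k.+4)))))))))).

(** * Integers coded by triples *)

Section CodedIntegers.
Variable S : comNzRingType.
Implicit Types a b c d e f p q r u : S.

Definition code_dom p a b :=
  (forall c, p * c = 0 -> c = 0) /\ ~ divides p 1 /\
  same_exp p p a a /\ same_exp p p b b.

Definition code_eq p a b q c d := exists c' d',
  same_exp q p c c' /\ same_exp q p d d' /\ a * d' = b * c'.

Definition code_add p a b q c d r e f := exists c' d' e' f',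
  (same_exp q p c c' /\ same_exp q p d d') /\
  (same_exp r p e e' /\ same_exp r p f f') /\ a * c' * f' = b * d' * e'.

(* With [a = p^n], [b = p^m], [c = q^n'], [d = q^m'] the [u]'s are [p^(n n')],
   [p^(m m')], [p^(n m')] and [p^(m n')]. *)
Definition code_mul p a b q c d r e f := exists u1 u2 u3 u4 e' f',
  ((same_exp q a c u1 /\ same_exp q b d u2) /\
   (same_exp q a d u3 /\ same_exp q b c u4)) /\
  (same_exp r p e e' /\ same_exp r p f f') /\ u1 * u2 * f' = u3 * u4 * e'.

Lemma sat_interp_dom (v : nat -> S) k (p a b : term) :
  below k p -> below k a -> below k b ->
  sat v (interp_dom k p a b) = code_dom (teval v p) (teval v a) (teval v b).
Proof.
move=> kp ka kb; apply: sat_and.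
  by apply: sat_all => c; rewrite sat_imp !sat_eq !teval_simpl.
apply: sat_and; first by apply: sat_not; rewrite sat_divides; below_tac.
by apply: sat_and; rewrite sat_same_exp.
Qed.

Lemma sat_interp_eq (v : nat -> S) k (p a b q c d : term) :
  below k p -> below k a -> below k b ->
  below k q -> below k c -> below k d ->
  sat v (interp_eq k p a b q c d) =
  code_eq (teval v p) (teval v a) (teval v b)
          (teval v q) (teval v c) (teval v d).
Proof.
move=> kp ka kb kq kc kd; apply: sat_ex => c'; apply: sat_ex => d'.
repeat apply: sat_and; rewrite ?sat_same_exp ?sat_eq; try (by below_tac);
  by rewrite !teval_simpl; [|by below_tac..].
Qed.

Lemma sat_interp_add (v : nat -> S) k (p a b q c d r e f : term) :
  below k p -> below k a -> below k b -> below k q -> below k c -> below k d ->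
  below k r -> below k e -> below k f ->
  sat v (interp_add k p a b q c d r e f) =
  code_add (teval v p) (teval v a) (teval v b)
           (teval v q) (teval v c) (teval v d)
           (teval v r) (teval v e) (teval v f).
Proof.
move=> kp ka kb kq kc kd kr ke kf.
do 4 apply: sat_ex => ?.
repeat apply: sat_and; rewrite ?sat_same_exp ?sat_eq; try (by below_tac);
  by rewrite !teval_simpl; [|by below_tac..].
Qed.

Lemma sat_interp_mul (v : nat -> S) k (p a b q c d r e f : term) :
  below k p -> below k a -> below k b -> below k q -> below k c -> below k d ->
  below k r -> below k e -> below k f ->
  sat v (interp_mul k p a b q c d r e f) =
  code_mul (teval v p) (teval v a) (teval v b)
           (teval v q) (teval v c) (teval v d)
           (teval v r) (teval v e) (teval v f).
Proof.
move=> kp ka kb kq kc kd kr ke kf.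
do 6 apply: sat_ex => ?.
repeat apply: sat_and; rewrite ?sat_same_exp ?sat_eq; try (by below_tac);
  by rewrite !teval_simpl; [|by below_tac..].
Qed.

(** Cancel [p] from both sides; a remaining equation [1 = p^(n+1)] would make [p] a unit. *)
Lemma regular_pow_inj p m n :
  (forall c, p * c = 0 -> c = 0) -> ~ divides p 1 -> p ^+ m = p ^+ n -> m = n.
Proof.
move=> regp nunit.
wlog lemn : m n / (m <= n)%N.
  by move=> W; case/orP: (leq_total m n) => le E; [|symmetry]; apply: W.
elim: m n lemn => [|m IH] [|n] // lemn; last first.
  rewrite !exprS => /eqP; rewrite -subr_eq0 -mulrBr => /eqP/regp/eqP.
  by rewrite subr_eq0 => /eqP/IH ->.
by rewrite exprS expr0 => E; case: nunit; exists (p ^+ n).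
Qed.

(** The difference of exponents is picked by choice, with default 0 when there is none; on the
    domain it is unique. *)
Definition coded_int p a b : int :=
  xget 0 (fun z : int => exists m n : nat,
    [/\ a = p ^+ m, b = p ^+ n & z = m%:Z - n%:Z]).

Lemma coded_intE p m n :
  (forall c, p * c = 0 -> c = 0) -> ~ divides p 1 ->
  coded_int p (p ^+ m) (p ^+ n) = m%:Z - n%:Z.
Proof.
move=> regp nunit; rewrite /coded_int.
set P := (X in xget _ X).
have : P (xget 0 P) by apply: xgetPex; exists (m%:Z - n%:Z), m, n.
by case=> m' [n' [/regular_pow_inj-> // /regular_pow_inj-> // ->]].
Qed.

Variables (x : S) (expand : {rmorphism S -> {poly S}}).
Hypothesis redS : forall a : S, a * a = 0 -> a = 0.
Hypothesis indS : indecomposable S.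
Hypothesis expand_x : expand x = 'X.
Hypothesis expandK : forall s, (expand s).[x] = s.

Let sameP := @same_expP S x expand redS indS expand_x expandK.

Lemma code_domP p a b : code_dom p a b ->
  [/\ forall c, p * c = 0 -> c = 0, ~ divides p 1 &
      exists m n, a = p ^+ m /\ b = p ^+ n].
Proof.
by case=> regp [nunit [/sameP[m [-> _]] /sameP[n [-> _]]]]; split => //; exists m, n.
Qed.

Lemma same_exp_pow p q n u : (forall c, p * c = 0 -> c = 0) -> ~ divides p 1 ->
  same_exp p q (p ^+ n) u <-> u = q ^+ n.
Proof.
move=> regp nunit; split=> [/sameP[n' [/regular_pow_inj-> //]]|->].
by apply/sameP; exists n.
Qed.

Lemma code_eqP p a b q c d : code_dom p a b -> code_dom q c d ->
  code_eq p a b q c d <-> coded_int p a b = coded_int q c d.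
Proof.
case/code_domP=> rp np [m [n [-> ->]]] /code_domP[rq nq [m' [n' [-> ->]]]].
rewrite !coded_intE //; split=> [[c' [d' [/same_exp_pow-> // [/same_exp_pow-> //]]]]|E].
  by rewrite -!exprD => /regular_pow_inj E; have := E rp np; lia.
exists (p ^+ m'), (p ^+ n'); do 2 (split; first exact/same_exp_pow).
by rewrite -!exprD; congr (_ ^+ _); lia.
Qed.

Lemma code_addP p a b q c d r e f :
  code_dom p a b -> code_dom q c d -> code_dom r e f ->
  code_add p a b q c d r e f <->
  coded_int p a b + coded_int q c d = coded_int r e f.
Proof.
case/code_domP=> rp np [m [n [-> ->]]] /code_domP[rq nq [m' [n' [-> ->]]]].
case/code_domP=> rr nr [m'' [n'' [-> ->]]].
rewrite !coded_intE //; split=> [[? [? [? [? [[]]]]]]|E].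
  move=> /same_exp_pow-> // /same_exp_pow-> // [[]].
  move=> /same_exp_pow-> // /same_exp_pow-> //.
  by rewrite -!exprD => /regular_pow_inj E; have := E rp np; lia.
exists (p ^+ m'), (p ^+ n'), (p ^+ m''), (p ^+ n'').
split; first by split; exact/same_exp_pow.
split; first by split; exact/same_exp_pow.
by rewrite -!exprD; congr (_ ^+ _); lia.
Qed.

Lemma code_mulP p a b q c d r e f :
  code_dom p a b -> code_dom q c d -> code_dom r e f ->
  code_mul p a b q c d r e f <->
  coded_int p a b * coded_int q c d = coded_int r e f.
Proof.
case/code_domP=> rp np [m [n [-> ->]]] /code_domP[rq nq [m' [n' [-> ->]]]].
case/code_domP=> rr nr [m'' [n'' [-> ->]]].
rewrite !coded_intE //; split=> [[? [? [? [? [? [? [[[]]]]]]]]]|E].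
  move=> /same_exp_pow-> // /same_exp_pow-> // [].
  move=> /same_exp_pow-> // /same_exp_pow-> // [[]].
  move=> /same_exp_pow-> // /same_exp_pow-> //.
  rewrite -!exprM -!exprD => /regular_pow_inj E; have := E rp np; nia.
exists ((p ^+ m) ^+ m'), ((p ^+ n) ^+ n'), ((p ^+ m) ^+ n'), ((p ^+ n) ^+ m').
exists (p ^+ m''), (p ^+ n'').
split; first by split; split; exact/same_exp_pow.
split; first by split; exact/same_exp_pow.
by rewrite -!exprM -!exprD; congr (_ ^+ _); nia.
Qed.

Lemma code_dom_surj (z : int) : exists m n,
  code_dom x (x ^+ m) (x ^+ n) /\ coded_int x (x ^+ m) (x ^+ n) = z.
Proof.
have [m [n ->]] : exists m n : nat, z = m%:Z - n%:Z.
  by case: z => k; [exists k, 0%N|exists 0%N, k.+1]; lia.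
have regx := var_regular expand_x expandK.
have nunit := var_not_unit expand_x.
exists m, n; split; last exact: coded_intE.
by do 2 split => //; split; apply/sameP; eexists.
Qed.

End CodedIntegers.

(** Three blocks of three variables occupy the indices 0 to 8, so bound variables start at 9. *)
Definition arith_interp := InterpFormulas 3
  (interp_dom 9 (TVar 0) (TVar 1) (TVar 2))
  (interp_eq 9 (TVar 0) (TVar 1) (TVar 2) (TVar 3) (TVar 4) (TVar 5))
  (interp_add 9 (TVar 0) (TVar 1) (TVar 2) (TVar 3) (TVar 4) (TVar 5)
                (TVar 6) (TVar 7) (TVar 8))
  (interp_mul 9 (TVar 0) (TVar 1) (TVar 2) (TVar 3) (TVar 4) (TVar 5)
                (TVar 6) (TVar 7) (TVar 8)).

Definition arith_coord (S : comNzRingType) (t : (idim arith_interp).-tuple S) : int :=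
  coded_int (nth 0 t 0) (nth 0 t 1) (nth 0 t 2).

Lemma arith_interpP (S : comNzRingType) (x : S) (h : {rmorphism S -> {poly S}}) :
  (forall a : S, a * a = 0 -> a = 0) -> indecomposable S ->
  h x = 'X -> (forall s, (h s).[x] = s) ->
  is_interpretation arith_interp (@arith_coord S).
Proof.
move=> redS indS hx hK.
have domE (t : (idim arith_interp).-tuple S) :
    sat (env t) (idom arith_interp) = code_dom (nth 0 t 0) (nth 0 t 1) (nth 0 t 2).
  by rewrite sat_interp_dom.
split=> [z|[[|p [|a [|b []]]] // pab] [[|q [|c [|d []]]] // qcd] ||].
- have [m [n [dom <-]]] := code_dom_surj redS indS hx hK z.
  by exists [tuple x; x ^+ m; x ^+ n]; rewrite ?domE.
- rewrite !domE sat_interp_eq // => dp dq.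
  exact: (code_eqP redS indS hx hK dp dq).
- move=> [[|p [|a [|b []]]] // pab] [[|q [|c [|d []]]] // qcd].
  move=> [[|r [|e [|f []]]] // ref].
  rewrite !domE sat_interp_add // => dp dq dr.
  exact: (code_addP redS indS hx hK dp dq dr).
move=> [[|p [|a [|b []]]] // pab] [[|q [|c [|d []]]] // qcd].
move=> [[|r [|e [|f []]]] // ref].
rewrite !domE sat_interp_mul // => dp dq dr.
exact: (code_mulP redS indS hx hK dp dq dr).
Qed.

Lemma interp_polynomial_ring (B : comNzRingType) (X : Type) (S : comNzRingType)
    (iota : {rmorphism B -> S}) (x : X -> S) :
  is_polynomial_ring iota x -> inhabited X -> reduced B -> indecomposable B ->
  is_interpretation arith_interp (@arith_coord S).
Proof.
move=> polyS [i] redB indB.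
(* The classical type supplies the decidable equality of indices that [expansion] and [retraction]
   test. *)
pose x' : {classic X} -> S := x.
have polyS' : is_polynomial_ring iota x' := polyS.
apply: (@arith_interpP S (x' i) (expansion polyS' i)).
- by move=> a; exact: polynomial_ring_sqr_eq0 polyS' _ redB.
- exact: polynomial_ring_indecomposable polyS' redB indB.
- exact: expansion_var.
exact: expansion_eval.
Qed.

Theorem theorem2p11 :
  exists Gam : interp_formulas,
    forall S : comNzRingType, class1 S \/ class2 S ->
      exists F : (idim Gam).-tuple S -> int, is_interpretation Gam F.
Proof.
exists arith_interp => S polyS; exists (@arith_coord S).
case: polyS => [[B [X [iota [x [polyS X0 redB indB _]]]]]|[R [iota [x [polyS _]]]]].
  exact: interp_polynomial_ring polyS X0 redB indB.
(* A field is reduced and indecomposable, so [R[x]] is the case of the index type [unit]. *)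
apply: interp_polynomial_ring polyS (inhabits tt) _ _.
  by move=> b [n /eqP]; rewrite expf_eq0 => /andP[_ /eqP].
move=> e /eqP; rewrite -subr_eq0 -{3}(mulr1 e) -mulrBr mulf_eq0 subr_eq0.
by case/orP=> /eqP; [left|right].
Qed.
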